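(* Let $k\ge1$ be an integer. If $G$ is a finite simple graph of order $n\ge 2$, then $$\gamma_{kR}(G)+d_R^k(G)\le n+2k,$$ with equality if and only if either $\gamma_{kR}(G)=n$ and $d_R^k(G)=2k$, or $\gamma_{kR}(G)=2k$ and $d_R^k(G)=n$.
   Context: Let $k\ge1$ be an integer. A Roman $k$-dominating function (RkDF) on a graph $G$ is a map $f:V(G)\to\{0,1,2\}$ such that every vertex $v$ with $f(v)=0$ has at least $k$ neighbors $u$ with $f(u)=2$. Its weight is $\sum_{v\in V(G)}f(v)$. The Roman $k$-domination number $\gamma_{kR}(G)$ is the minimum weight of an RkDF on $G$. A set $\{f_1,\ldots,f_d\}$ of pairwise distinct RkDFs on $G$ with $\sum_{i=1}^d f_i(v)\le 2k$ for every $v\in V(G)$ is a Roman $(k,k)$-dominating family on $G$; the maximum number of functions in such a family is the Roman $(k,k)$-domatic number $d_R^k(G)$. *)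

(* Defs.v *)
(* Finite simple graphs are symmetric irreflexive relations e on a finType T. *)
From mathcomp Require Import all_boot.
Set Implicit Arguments.
Unset Strict Implicit.
Unset Printing Implicit Defensive.

Section RomanDomination.

Variables (T : finType) (e : rel T) (k : nat).

Implicit Types (f : {ffun T -> 'I_3}) (F : {set {ffun T -> 'I_3}}).

Definition RkDF f : bool :=
  [forall v, (f v == 0 :> nat) ==> (k <= #|[set u | e v u & f u == 2 :> nat]|)].

Definition weight f : nat := \sum_v f v.

(* The default value of the arg min below; it is always an RkDF, so the
   minimum in gammakR is a genuine one. *)
Definition const1 : {ffun T -> 'I_3} := [ffun=> inord 1].

Lemma RkDF_const1 : RkDF const1.
Proof. by apply/forallP => v; rewrite ffunE inordK. Qed.

Definition gammakR : nat := weight [arg min_(f < const1 | RkDF f) weight f].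

Lemma gammakR_attained : exists2 f, RkDF f & weight f = gammakR.
Proof.
rewrite /gammakR; case: arg_minnP => [|f Rf _]; first exact: RkDF_const1.
by exists f.
Qed.

Lemma gammakR_min f : RkDF f -> gammakR <= weight f.
Proof.
by move=> Rf; rewrite /gammakR; case: arg_minnP => [|g _]; [exact: RkDF_const1|exact].
Qed.

(* A family is a set of functions, so its members are pairwise distinct. *)
Definition RkkD_family F : bool :=
  [forall f in F, RkDF f] && [forall v, \sum_(f in F) f v <= 2 * k].

Definition dRk : nat := \max_(F : {set {ffun T -> 'I_3}} | RkkD_family F) #|F|.

End RomanDomination.

(* Main.v *)
(* Write g = gammakR, d = dRk and n for the order.  Summing the values of a
   family over all vertices gives g d <= 2kn, and g <= n since the constant 1
   is an RkDF.  An RkDF taking the value 0 has weight at least 2k, so either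
   2k <= g <= n, or g = n.  In the first case
   (g - 2k)(n - g) >= 0 means g^2 + 2kn <= (n + 2k) g, hence g + d <= n + 2k,
   strictly unless g is one of the endpoints 2k and n. *)
Require Import Defs.
From mathcomp Require Import all_boot zify.

Section RomanDominationBounds.

Variables (T : finType) (e : rel T) (k : nat).

Lemma gammakR_le_card : gammakR e k <= #|T|.
Proof.
apply: leq_trans (gammakR_min (RkDF_const1 e k)) _.
rewrite /weight -sum1_card leq_sum // => v _.
by rewrite ffunE inordK.
Qed.

(** A vertex of value 0 has at least [k] neighbors of value 2; without such a vertex, every value is
    at least 1. *)
Lemma RkDF_weight_lower_bound (f : {ffun T -> 'I_3}) :
  RkDF e k f -> 2 * k <= weight f \/ #|T| <= weight f.
Proof.
move=> /forallP Rf; case: (boolP [exists v, f v == 0 :> nat]) => [|/existsPn fN0].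
  case/existsP=> v fv0; left.
  have := Rf v; rewrite fv0 /= => le_k.
  set A := [set _ | _ & _] in le_k.
  rewrite /weight (bigID (mem A)) /=; apply: leq_trans (leq_addr _ _).
  rewrite (eq_bigr (fun=> 2)) => [|u]; last by rewrite inE => /andP[_ /eqP].
  by rewrite sum_nat_const mulnC leq_mul2r.
by right; rewrite /weight -sum1_card leq_sum // => v _; rewrite lt0n fN0.
Qed.

Lemma RkkD_family_mul_gammakR (F : {set {ffun T -> 'I_3}}) :
  RkkD_family e k F -> gammakR e k * #|F| <= 2 * k * #|T|.
Proof.
case/andP=> /forall_inP RF /forallP le_2k.
rewrite mulnC -sum_nat_const.
apply: (@leq_trans (\sum_(f in F) weight f)).
  by apply: leq_sum => f /RF /gammakR_min.
(* The same total, now counted vertex by vertex. *)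
rewrite exchange_big /= mulnC -sum_nat_const.
by apply: leq_sum => v _; apply: le_2k.
Qed.

Lemma gammakR_mul_dRk : gammakR e k * dRk e k <= 2 * k * #|T|.
Proof.
rewrite /dRk; elim/big_ind: _ => [|x y lex ley|F]; first by rewrite muln0.
  by rewrite maxnMr geq_max lex.
exact: RkkD_family_mul_gammakR.
Qed.

End RomanDominationBounds.

Theorem theorem4 (k : nat) (T : finType) (e : rel T)
    (k_ge1 : 1 <= k) (e_sym : symmetric e) (e_irr : irreflexive e)
    (n_ge2 : 2 <= #|T|) :
  gammakR e k + dRk e k <= #|T| + 2 * k /\
  (gammakR e k + dRk e k = #|T| + 2 * k <->
     (gammakR e k = #|T| /\ dRk e k = 2 * k) \/
     (gammakR e k = 2 * k /\ dRk e k = #|T|)).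
Proof.
have le_n := gammakR_le_card T e k.
have le_gd := gammakR_mul_dRk T e k.
have lb : 2 * k <= gammakR e k \/ #|T| <= gammakR e k.
  by have [f /RkDF_weight_lower_bound + <-] := gammakR_attained e k.
move: (gammakR e k) (dRk e k) #|T| => g d n in n_ge2 le_n le_gd lb *.
have [eq_gn|neq_gn] := eqVneq g n.
  have : d <= 2 * k by rewrite -(leq_pmul2l (m := n)); lia.
  by lia.
have [eq_g2k|neq_g2k] := eqVneq g (2 * k).
  (* Here [k_ge1] makes [g] positive, so it cancels in [le_gd]. *)
  have : d <= n by rewrite -(leq_pmul2l (m := g)); nia.
  by lia.
suff: g + d < n + 2 * k by lia.
have {lb} lt_2kg : 2 * k < g by lia.
have lt_gn : g < n by lia.
(* Without truncated subtraction, the product [(g - 2 * k) * (n - g)] becomes [a.+1 * b.+1], which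
   is positive and makes the bound strict. *)
have [a def_g] : exists a, g = 2 * k + a.+1 by exists (g - 2 * k).-1; lia.
have [b def_n] : exists b, n = g + b.+1 by exists (n - g).-1; lia.
rewrite -(ltn_pmul2l (m := g)); nia.
Qed.
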